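(* Let $a>0$, $g\in\mathbb R$, and consider the integrable Hamiltonian system on $M^4_{a,g}$ with Hamiltonian $$H=\frac12\Bigl(S_1^2+S_2^2+\frac{S_3^2}\beta\Bigr)+g_1(\mathbf R^2,R_3)(S_1R_2-S_2R_1)+g_2(\mathbf R^2,R_3)\langle\mathbf S,\mathbf R\rangle+g_3(\mathbf R^2,R_3)S_3+V(\mathbf R^2,R_3)$$ and integral $K=S_3$. For the singular points of rank $0$, $P_\pm=\bigl(0,0,\pm\frac g{\sqrt a},0,0,\pm\sqrt a\bigr)$, put $R_3=\pm\sqrt a$ respectively and $$q=\frac{g^2}{4R_3^2}-R_3^2\,g_1^2(a,R_3)-gR_3\frac{\partial g_2}{\partial R_3}(a,R_3)-g\frac{\partial g_3}{\partial R_3}(a,R_3)-R_3\frac{\partial V}{\partial R_3}(a,R_3).$$ Then the point $P_\pm$ is non-degenerate if and only if $q\neq0$; moreover, if $P_\pm$ is non-degenerate, its type is center-center if $q>0$ and focus-focus if $q<0$.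
   Context: On $\mathrm e(3)^*=\mathbb R^6$ with linear coordinates $(\mathbf S,\mathbf R)=(S_1,S_2,S_3,R_1,R_2,R_3)$ consider the Lie–Poisson bracket $\{S_i,S_j\}=\varepsilon_{ijk}S_k$, $\{S_i,R_j\}=\varepsilon_{ijk}R_k$, $\{R_i,R_j\}=0$. For a smooth function $f$, $\mathrm{sgrad} f$ is the Hamiltonian vector field $\dot x_i=\{x_i,f\}$. The Casimir functions are $F_1=\langle\mathbf R,\mathbf R\rangle=\mathbf R^2$ and $F_2=\langle\mathbf S,\mathbf R\rangle$; for $a>0$ the orbit $M^4_{a,g}=\{F_1=a,\ F_2=g\}$ is a 4-dimensional symplectic leaf. In the Hamiltonian, $\beta>0$ is a constant and $g_1,g_2,g_3,V$ are smooth functions of two variables (the values of $\mathbf R^2$ and $R_3$) in the range $\mathbf R^2>0$; $\partial/\partial R_3$ of these functions denotes the derivative with respect to the second argument. $H$ commutes with $K$. A singular point has rank $0$ if $\mathrm{sgrad} H=\mathrm{sgrad} K=0$ there. A rank $0$ point $P$ on a symplectic 4-manifold is non-degenerate iff (i) the linearizations $A_H,A_K$ of $\mathrm{sgrad} H,\mathrm{sgrad} K$ at $P$ (on the tangent space of the symplectic manifold) are linearly independent and (ii) some linear combination $\lambda A_H+\mu A_K$ has four different non-zero eigenvalues. A non-degenerate point is of center-center type if the eigenvalues of such a combination have the form $\pm i\alpha,\pm i\gamma$ (with $\alpha,\gamma$ real), and of focus-focus type if they have the form $\pm\alpha\pm i\gamma$ with $\alpha,\gamma$ real, non-zero. *)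

(* Defs.v *)
From HB Require Import structures.
From mathcomp Require Import all_boot all_order all_algebra.
From mathcomp Require Import complex.
From mathcomp Require Import all_classical all_reals all_analysis.

Set Implicit Arguments.
Unset Strict Implicit.
Unset Printing Implicit Defensive.

Import Order.TTheory GRing.Theory Num.Theory.
Import numFieldNormedType.Exports.

Local Open Scope classical_set_scope.
Local Open Scope ring_scope.
Local Open Scope complex_scope.

(* U is meant to be open, so that the conditions only involve f on U. *)
Fixpoint Ck_on (R : realType) (V : normedModType R) (k : nat) (U : set V)
    (f : V -> R) : Prop :=
  if k is k'.+1 then
    (forall x, U x -> differentiable f x) /\
    (forall v, Ck_on k' U (fun x => 'D_v f x))
  else forall x, U x -> {for x, continuous f}.

Definition smooth_on (R : realType) (V : normedModType R) (U : set V)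
    (f : V -> R) : Prop :=
  forall k, Ck_on k U f.

Definition partial2 (R : realType) (f : R * R -> R) (r z : R) : R :=
  derive1 (fun t : R => f (r, t)) z.

(* A point of e(3)^* = R^6 is the row vector (S_1, S_2, S_3, R_1, R_2, R_3);
   indices in the code start at 0. *)
Definition Svec (R : realType) (x : 'rV[R]_6) : 'rV[R]_3 :=
  @lsubmx R 1 3 3 x.
Definition Rvec (R : realType) (x : 'rV[R]_6) : 'rV[R]_3 :=
  @rsubmx R 1 3 3 x.

Definition S1 (R : realType) (x : 'rV[R]_6) : R := Svec x 0 0.
Definition S2 (R : realType) (x : 'rV[R]_6) : R := Svec x 0 1.
Definition S3 (R : realType) (x : 'rV[R]_6) : R := Svec x 0 ord_max.
Definition R1 (R : realType) (x : 'rV[R]_6) : R := Rvec x 0 0.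
Definition R2 (R : realType) (x : 'rV[R]_6) : R := Rvec x 0 1.
Definition R3 (R : realType) (x : 'rV[R]_6) : R := Rvec x 0 ord_max.

Definition dot3 (R : realType) (u v : 'rV[R]_3) : R :=
  \sum_(i < 3) u 0 i * v 0 i.

(* Addition on 'I_3 is modulo 3: (i, i + 1, i + 2) are the even permutations. *)
Definition levi_civita (R : realType) (i j k : 'I_3) : R :=
  if (j == i + 1) && (k == i + 1 + 1) then 1
  else if (j == i + 1 + 1) && (k == i + 1) then -1
  else 0.

Definition eps_mx (R : realType) (v : 'rV[R]_3) : 'M[R]_3 :=
  \matrix_(i, j) \sum_(k < 3) levi_civita R i j k * v 0 k.

(* Entry (i, j) is {x_i, x_j}; note that
   {R_i, S_j} = - eps_jik R_k = eps_ijk R_k. *)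
Definition poisson_mx (R : realType) (x : 'rV[R]_6) : 'M[R]_6 :=
  block_mx (eps_mx (Svec x)) (eps_mx (Rvec x)) (eps_mx (Rvec x)) 0.

Definition bracket (R : realType) (f h : 'rV[R]_6 -> R) (x : 'rV[R]_6) : R :=
  \sum_(i < 6) \sum_(j < 6)
    poisson_mx x i j * 'D_(delta_mx 0 i) f x * 'D_(delta_mx 0 j) h x.

Definition sgrad (R : realType) (f : 'rV[R]_6 -> R) (x : 'rV[R]_6) :
    'rV[R]_6 :=
  \row_(i < 6) bracket (fun y : 'rV[R]_6 => y 0 i) f x.

Definition F1 (R : realType) (x : 'rV[R]_6) : R := dot3 (Rvec x) (Rvec x).
Definition F2 (R : realType) (x : 'rV[R]_6) : R := dot3 (Svec x) (Rvec x).

Definition leaf (R : realType) (a g : R) : set 'rV[R]_6 :=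
  [set x | F1 x = a /\ F2 x = g].

(* The row space of this matrix is ker dF1 :&: ker dF2, the tangent space at x
   of the leaf through x when Rvec x != 0. *)
Definition leaf_tangent (R : realType) (x : 'rV[R]_6) : 'M[R]_6 :=
  kermx (jacobian (fun y : 'rV[R]_6 => \row_(i < 2) [:: F1 y; F2 y]`_i) x).

(* Matrix, in a basis of the tangent space of the leaf, of the linearization of
   sgrad f at an equilibrium x.  Matrices act on row vectors; sgrad f is tangent
   to the leaves, so its derivative at x preserves the tangent space. *)
Definition linearization (R : realType) (f : 'rV[R]_6 -> R) (x : 'rV[R]_6) :
    'M[R]_(\rank (leaf_tangent x)) :=
  restrictmx (leaf_tangent x) (jacobian (sgrad f) x).

Definition ceigenvalue (R : realType) n (A : 'M[R]_n) (z : R[i]) : bool :=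
  eigenvalue (map_mx (fun t : R => t%:C) A) z.

(* The leaves of interest have dimension 4, so in the applications these are
   all the eigenvalues of A. *)
Definition four_distinct_nonzero_eigenvalues (R : realType) n
    (A : 'M[R]_n) : Prop :=
  exists s : seq R[i],
    [/\ size s = 4%N, uniq s, 0 \notin s & all (ceigenvalue A) s].

Definition rank0_point (R : realType) (a g : R) (H K : 'rV[R]_6 -> R)
    (P : 'rV[R]_6) : Prop :=
  [/\ leaf a g P, sgrad H P = 0 & sgrad K P = 0].

Definition lin_comb (R : realType) (H K : 'rV[R]_6 -> R) (P : 'rV[R]_6)
    (lam mu : R) : 'M[R]_(\rank (leaf_tangent P)) :=
  lam *: linearization H P + mu *: linearization K P.

Definition nondegenerate_rank0 (R : realType) (a g : R) (H K : 'rV[R]_6 -> R)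
    (P : 'rV[R]_6) : Prop :=
  [/\ rank0_point a g H K P,
      free [:: linearization H P; linearization K P] &
      exists lam mu : R,
        four_distinct_nonzero_eigenvalues (lin_comb H K P lam mu)].

Definition center_center (R : realType) (a g : R) (H K : 'rV[R]_6 -> R)
    (P : 'rV[R]_6) : Prop :=
  nondegenerate_rank0 a g H K P /\
  exists lam mu : R,
    four_distinct_nonzero_eigenvalues (lin_comb H K P lam mu) /\
    exists alpha gamma : R,
      ceigenvalue (lin_comb H K P lam mu) =i
        [:: 0 +i* alpha; 0 +i* (- alpha); 0 +i* gamma; 0 +i* (- gamma)].

Definition focus_focus (R : realType) (a g : R) (H K : 'rV[R]_6 -> R)
    (P : 'rV[R]_6) : Prop :=
  nondegenerate_rank0 a g H K P /\
  exists lam mu : R,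
    four_distinct_nonzero_eigenvalues (lin_comb H K P lam mu) /\
    exists alpha gamma : R,
      [/\ alpha != 0, gamma != 0 &
        ceigenvalue (lin_comb H K P lam mu) =i
          [:: alpha +i* gamma; alpha +i* (- gamma);
              (- alpha) +i* gamma; (- alpha) +i* (- gamma)]].

Definition hamiltonian (R : realType) (beta : R) (g1 g2 g3 V : R * R -> R)
    (x : 'rV[R]_6) : R :=
  2^-1 * (S1 x ^+ 2 + S2 x ^+ 2 + S3 x ^+ 2 / beta)
  + g1 (F1 x, R3 x) * (S1 x * R2 x - S2 x * R1 x)
  + g2 (F1 x, R3 x) * F2 x
  + g3 (F1 x, R3 x) * S3 x
  + V (F1 x, R3 x).

(* r3 is the value of R_3 at the point considered. *)
Definition qdisc (R : realType) (g1 g2 g3 V : R * R -> R) (a g r3 : R) : R :=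
  g ^+ 2 / (4 * r3 ^+ 2)
  - r3 ^+ 2 * g1 (a, r3) ^+ 2
  - g * r3 * partial2 g2 a r3
  - g * partial2 g3 a r3
  - r3 * partial2 V a r3.

(* P_+ for s = false, P_- for s = true. *)
Definition Ppm (R : realType) (a g : R) (s : bool) : 'rV[R]_6 :=
  \row_(i < 6) [:: 0; 0; (-1) ^+ s * (g / Num.sqrt a);
                   0; 0; (-1) ^+ s * Num.sqrt a]`_i.

(* Main.v *)
Require Import Defs.
From HB Require Import structures.
From mathcomp Require Import all_boot all_order all_algebra.
From mathcomp Require Import complex.
From mathcomp Require Import all_classical all_reals all_analysis.
From mathcomp Require Import ring lra.

Set Implicit Arguments.
Unset Strict Implicit.
Unset Printing Implicit Defensive.

Import Order.TTheory GRing.Theory Num.Theory.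
Import numFieldNormedType.Exports.

Local Open Scope classical_set_scope.
Local Open Scope ring_scope.
Local Open Scope complex_scope.

(* With z = S_1 + i S_2 and w = R_1 + i R_2 as coordinates on the tangent space
   of the leaf at P, the rotational symmetry generated by K makes both
   linearizations complex linear: A_K is multiplication by i and A_H is a complex
   2x2 matrix M, from which all derivatives with respect to R^2 cancel.  The
   trace of M is purely imaginary, say 2 i omega, and the discriminant
   (tr M / 2)^2 - det M equals -q.  Hence lam A_H + mu A_K has the eigenvalues
   i (lam omega + mu) +- lam sqrt(-q) and their conjugates. *)

(** * Realification of complex matrices *)

(** The trace of M is imaginary and its discriminant real because a complex linear Hamiltonian map
    is skew-adjoint for a Hermitian form; below, both facts are read off explicit entries.
    Derivatives with respect to R^2 cancel because, along the leaf, they enter the first and second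
    differentials of H only as those of a constant multiple of the Casimir F_1, whose Hamiltonian
    field is identically zero. Since A_K is scalar and M has the off-diagonal entry -i R_3, the
    linearizations are independent for every q, so condition (ii) alone decides non-degeneracy;
    there mu shifts the rotation frequency freely and leaves the discriminant unchanged. The formal
    obstacle is that [linearization] lives in an unspecified basis of a space whose dimension is a
    rank. Both linearizations are therefore carried to one explicit 4-dimensional plane by the same
    change of basis. *)

Lemma eigenvalue_det (F : fieldType) n (A : 'M[F]_n) (k : F) :
  eigenvalue A k = (\det (A - k%:M) == 0).
Proof.
by rewrite /eigenvalue /eigenspace kermx_eq0 row_free_unit unitmxE unitfE negbK.
Qed.

(** X and Y are formally rectangular because the sizes to be compared, a rank and 2 + 2, are equal
    but not convertible. *)
Lemma eigenvalue_conj (F : fieldType) m n (A : 'M[F]_n) (X : 'M[F]_(m, n))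
    (Y : 'M[F]_(n, m)) (k : F) :
  X *m Y = 1%:M -> Y *m X = 1%:M ->
  eigenvalue (X *m A *m Y) k = eigenvalue A k.
Proof.
move=> XY YX; apply/eigenvalueP/eigenvalueP => -[w wA w0].
  exists (w *m X); last first.
    by apply: contraNneq w0 => wX; rewrite -[w]mulmx1 -XY mulmxA wX mul0mx.
  rewrite scalemxAl -wA -!mulmxA YX mulmx1; congr (_ *m _).
exists (w *m Y); last first.
  by apply: contraNneq w0 => wY; rewrite -[w]mulmx1 -YX mulmxA wY mul0mx.
by rewrite !mulmxA -(mulmxA w) YX mulmx1 wA scalemxAl.
Qed.

(** X and Y change between the basis [row_base T], of which nothing explicit is known, and the
    chosen basis E. They are quantified before J, so that one pair serves A_H and A_K and hence all
    their combinations. *)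
Lemma restrictmx_conj (F : fieldType) m n (T : 'M[F]_n) (E : 'M[F]_(m, n)) :
  row_free E -> (T :=: E)%MS ->
  exists (X : 'M[F]_(\rank T, m)) (Y : 'M[F]_(m, \rank T)),
    [/\ X *m Y = 1%:M, Y *m X = 1%:M & forall J A,
      E *m J = A *m E -> conjmx (row_base T) J = X *m A *m Y].
Proof.
move=> Efree TE; pose B := row_base T.
have BE : (B <= E)%MS by rewrite eq_row_base TE.
have EB : (E <= B)%MS by rewrite eq_row_base TE.
exists (B *m pinvmx E), (E *m pinvmx B); split.
- by rewrite mulmxA mulmxKpV // mulmxVp // row_base_free.
- by rewrite mulmxA mulmxKpV // mulmxVp.
move=> J A EJ; rewrite /conjmx -/B (mulmxA (B *m pinvmx E *m A) E).
by rewrite -(mulmxA _ A E) -EJ (mulmxA _ E J) mulmxKpV.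
Qed.

(* The real matrix of a complex linear map acting on row vectors: u + i v is
   represented by the row (u, v). *)
Definition realify (R : rcfType) n (M : 'M[R[i]]_n) : 'M[R]_(n + n) :=
  block_mx (map_mx (@complex.Re R) M) (map_mx (@complex.Im R) M)
    (- map_mx (@complex.Im R) M) (map_mx (@complex.Re R) M).

Lemma realifyD (R : rcfType) n (M N : 'M[R[i]]_n) :
  realify (M + N) = realify M + realify N.
Proof. by rewrite /realify !map_mxD opprD add_block_mx. Qed.

Lemma realifyZ (R : rcfType) n (c : R) (M : 'M[R[i]]_n) :
  realify (c%:C *: M) = c *: realify M.
Proof.
have reZ : map_mx (@complex.Re R) (c%:C *: M) = c *: map_mx (@complex.Re R) M.
  by apply/matrixP => i j; rewrite !mxE; case: (M i j) => a b /=; ring.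
have imZ : map_mx (@complex.Im R) (c%:C *: M) = c *: map_mx (@complex.Im R) M.
  by apply/matrixP => i j; rewrite !mxE; case: (M i j) => a b /=; ring.
by rewrite /realify scale_block_mx scalerN reZ imZ.
Qed.

Lemma ceigenvalue_realify (R : realType) n (M : 'M[R[i]]_n) (k : R[i]) :
  ceigenvalue (realify M) k =
    eigenvalue M k || eigenvalue (map_mx (@conjc R) M) k.
Proof.
pose X := map_mx (fun t => (complex.Re t)%:C) M.
pose Y := map_mx (fun t => (complex.Im t)%:C) M.
have MXY : M = X + 'i *: Y.
  by apply/matrixP => i j; rewrite !mxE; exact: complexE.
have MXYc : map_mx (@conjc R) M = X - 'i *: Y.
  apply/matrixP => i j; rewrite !mxE; by case: (M i j) => a b; simpc.
have -> : ceigenvalue (realify M) k = eigenvalue (block_mx X Y (- Y) X) k.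
  rewrite /ceigenvalue; congr (eigenvalue _ k); rewrite /realify map_block_mx.
  by congr block_mx; apply/matrixP => i j; rewrite !mxE // rmorphN.
have i2 : 'i * 'i = -1 :> R[i] by rewrite -expr2 sqr_i.
rewrite MXYc {}[in X in X || _]MXY.
(* Over the complex numbers the row (u, v) is an eigenvector as soon as one of
   u + i v, u - i v is an eigenvector of M, respectively of its conjugate. *)
apply/idP/orP => [/eigenvalueP[w]|].
  rewrite -[w]hsubmxK; set u := lsubmx w; set v := rsubmx w.
  rewrite mul_row_block !mulmxN scale_row_mx => /eq_row_mx[eu ev] w0.
  have kv : k *: ('i *: v) = 'i *: (k *: v) by rewrite !scalerA mulrC.
  have [up0|up0] := eqVneq (u + 'i *: v) 0; last first.
    left; apply/eigenvalueP; exists (u + 'i *: v); last exact: up0.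
    rewrite scalerDr kv -eu -ev mulmxDl !mulmxDr -!scalemxAl -!scalemxAr.
    rewrite scalerA i2; move: (u *m X) (u *m Y) (v *m X) (v *m Y) => p q r t.
    by apply/rowP => j; rewrite !mxE; ring.
  right; apply/eigenvalueP; exists (u - 'i *: v).
    rewrite scalerBr kv -eu -ev mulmxBl !mulmxBr -!scalemxAl -!scalemxAr.
    rewrite scalerA i2; move: (u *m X) (u *m Y) (v *m X) (v *m Y) => p q r t.
    by apply/rowP => j; rewrite !mxE; ring.
  apply: contraNneq w0 => um0.
  have u0 : u = 0.
    apply: (scalerI (a := 2)); first by rewrite pnatr_eq0.
    by rewrite scaler0 scaler_nat mulr2n -{1}(addrK ('i *: v) u) up0 sub0r addrC
      um0.
  move: up0; rewrite u0 add0r => /eqP.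
  rewrite scaler_eq0 eq_complex /= oner_eq0 andbF /= => /eqP ->.
  by rewrite row_mx0.
(* For e = i or -i, the row (w, - e w) is an eigenvector for e of the complex structure (u, v) -> (-
   v, u); on such rows the block matrix acts as X + e Y, which is M or its conjugate. *)
have eig (e : R[i]) (w : 'rV_n) : e * e = -1 -> w != 0 ->
    w *m (X + e *: Y) = k *: w -> eigenvalue (block_mx X Y (- Y) X) k.
  move=> e2 w0 wk; apply/eigenvalueP; exists (row_mx w (- e *: w)); last first.
    by apply: contraNneq w0; rewrite -row_mx0 => /eq_row_mx[->].
  rewrite mul_row_block scale_row_mx scalerA [k * _]mulrC -scalerA -wk.
  rewrite mulmxDr -!scalemxAl -!scalemxAr mulmxN scaleNr scalerN opprK.
  congr row_mx; move: (w *m X) (w *m Y) => p q.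
  by apply/rowP => j; rewrite !mxE mulrDr mulrA (mulNr e e) e2; ring.
case=> /eigenvalueP[w wk w0]; first exact: (eig 'i w).
by apply: (eig (- 'i) w); rewrite ?mulrNN ?scaleNr.
Qed.

Lemma det_mx2 (F : comNzRingType) (A : 'M[F]_2) :
  \det A = A 0 0 * A 1 1 - A 0 1 * A 1 0.
Proof.
rewrite (expand_det_row _ 0) !big_ord_recl big_ord0 /cofactor !det_mx11 !mxE /=.
rewrite /bump /= !addn0 !expr0 expr1 mul1r addr0 mulN1r mulrN.
by congr (_ * A _ _ - A _ _ * A _ _); apply/val_inj.
Qed.

(** Here i nu is half the trace and d half the difference of the diagonal entries, so the
    characteristic polynomial is (k - i nu)^2 + D. As D is real, conjugating M only changes the sign
    of nu. *)
Lemma ceigenvalue_realify2 (R : realType) (M : 'M[R[i]]_2) (d : R[i])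
    (nu D : R) :
  M 0 0 = 0 +i* nu + d -> M 1 1 = 0 +i* nu - d ->
  d ^+ 2 + M 0 1 * M 1 0 = (- D)%:C ->
  forall k : R[i], ceigenvalue (realify M) k =
    ((k - 0 +i* nu) ^+ 2 == (- D)%:C) || ((k + 0 +i* nu) ^+ 2 == (- D)%:C).
Proof.
move=> M00 M11 MD k; rewrite ceigenvalue_realify !eigenvalue_det !det_mx2.
rewrite !mxE /= !mulr1n !mulr0n !subr0 M00 M11; congr orb.
  by rewrite -[RHS]subr_eq0 -MD; congr (_ == 0); ring.
have -> : (- D)%:C = conjc (- D)%:C by rewrite /= oppr0.
rewrite -MD -[RHS]subr_eq0 !rmorphD /= !rmorphM /= rmorphN /=.
have -> : (0 -i* nu)= - (0 +i* nu) :> R[i] by rewrite -[RHS]/(_ +i* _) oppr0.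
by congr (_ == 0); ring.
Qed.

(** With zero discriminant every eigenvalue is i nu or - i nu, hence at most two of them are
    distinct. *)
Lemma not_four_distinct_nonzero_eigenvalues (R : realType) n (A : 'M[R]_n) (nu : R) :
  (forall k : R[i], ceigenvalue A k =
    ((k - 0 +i* nu) ^+ 2 == 0) || ((k + 0 +i* nu) ^+ 2 == 0)) ->
  ~ four_distinct_nonzero_eigenvalues A.
Proof.
move=> sp [s [s4 us _ /allP sM]].
have /(uniq_leq_size us) : {subset s <= [:: 0 +i* nu; - (0 +i* nu)]}.
  by move=> k /sM; rewrite sp !sqrf_eq0 subr_eq0 addr_eq0 !inE.
by rewrite s4.
Qed.

Lemma center_spectrum (R : realType) n (A : 'M[R]_n) (nu d : R) :
  (forall k : R[i], ceigenvalue A k =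
    ((k - 0 +i* nu) ^+ 2 == (- d ^+ 2)%:C) ||
    ((k + 0 +i* nu) ^+ 2 == (- d ^+ 2)%:C)) ->
  ceigenvalue A =i
    [:: 0 +i* (nu + d); 0 +i* (- (nu + d)); 0 +i* (nu - d); 0 +i* (- (nu - d))].
Proof.
move=> sp k; rewrite -topredE /= sp !inE.
have -> : (- d ^+ 2)%:C = (0 +i* d) ^+ 2.
  rewrite [RHS]expr2; apply/eqP; rewrite eq_complex /=.
  by rewrite !(mul0r, mulr0, addr0, sub0r) -expr2 !eqxx.
rewrite !eqf_sqr; case: k => x y; rewrite !eq_complex /= ?(oppr0, addr0).
case: (x == 0) => //=.
have -> : (y - nu == d) = (y == nu + d) by rewrite subr_eq addrC.
have -> : (y - nu == - d) = (y == nu - d) by rewrite subr_eq addrC.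
have -> : (y + nu == d) = (y == - (nu - d)).
  by rewrite -subr_eq0 -[RHS]subr_eq0; congr (_ == 0); ring.
have -> : (y + nu == - d) = (y == - (nu + d)).
  by rewrite -subr_eq0 -[RHS]subr_eq0; congr (_ == 0); ring.
case: (y == nu + d); case: (y == nu - d); case: (y == - (nu + d));
  by case: (y == - (nu - d)).
Qed.

Lemma focus_spectrum (R : realType) n (A : 'M[R]_n) (nu d : R) :
  (forall k : R[i], ceigenvalue A k =
    ((k - 0 +i* nu) ^+ 2 == (d ^+ 2)%:C) ||
    ((k + 0 +i* nu) ^+ 2 == (d ^+ 2)%:C)) ->
  ceigenvalue A =i
    [:: d +i* nu; d +i* (- nu); (- d) +i* nu; (- d) +i* (- nu)].
Proof.
move=> sp k; rewrite -topredE /= sp !inE.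
rewrite rmorphXn /= !eqf_sqr; case: k => x y; rewrite !eq_complex /=.
rewrite !(oppr0, addr0, subr_eq0, addr_eq0).
by case: (x == d); case: (x == - d); case: (y == nu); case: (y == - nu).
Qed.

Lemma four_distinct_nonzero_eigenvaluesP (R : realType) n (A : 'M[R]_n)
    (s : seq R[i]) :
  size s = 4%N -> uniq s -> 0 \notin s -> ceigenvalue A =i s ->
  four_distinct_nonzero_eigenvalues A.
Proof. by move=> s4 us s0 As; exists s; split=> //; apply/allP => k; rewrite -As. Qed.

(** * Differentials along a set of directions *)

Lemma near_eq_differentiable (R : numFieldType) (V W : normedModType R)
    (f g : V -> W) (x : V) :
  (\forall y \near x, f y = g y) -> differentiable f x -> differentiable g x.
Proof.
move=> fg df; have fgx : f x = g x by exact: nbhs_singleton fg.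
have dg : g \o shift x = cst (g x) + 'd f x +o_ 0 id.
  apply/eqaddoP => e e0.
  have /eqaddoP fe := diff_locally df.
  have {}fe := fe _ e0.
  have fg0 : \forall h \near (0 : V), f (h + x) = g (h + x).
    by move: fg; rewrite (near_shift 0 x) subr0.
  near=> h.
  rewrite -fgx !fctE /=; have -> : g (h + x) = f (h + x) by apply/esym; near: h.
  by near: h.
apply/diff_locallyP; rewrite (diff_unique (diff_continuous df) dg).
by split=> //; exact: diff_continuous.
Unshelve. all: by end_near. Qed.

(* Only the values of the differential on the directions in D are prescribed, so
   that second partial derivatives of the coefficients drop out of computations
   along the tangent space of the leaf. *)
Definition diff_along (R : numFieldType) (V W : normedModType R) (x : V)
    (D : V -> Prop) (f : V -> W) (df : V -> W) :=
  differentiable f x /\ forall v, D v -> 'd f x v = df v.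

Lemma diff_along_eq (R : numFieldType) (V W : normedModType R) (x : V)
    (D : V -> Prop) (f df dg : V -> W) :
  diff_along x D f df -> (forall v, D v -> df v = dg v) -> diff_along x D f dg.
Proof. by move=> [fx fd] e; split=> // v Dv; rewrite fd // e. Qed.

Section DiffAlong.
Context {R : numFieldType} {V : normedModType R} (x : V) (D : V -> Prop).
Implicit Types f g : V -> R.

Lemma diff_alongD f g df dg :
  diff_along x D f df -> diff_along x D g dg ->
  diff_along x D (fun y => f y + g y) (fun v => df v + dg v).
Proof.
move=> [fx fd] [gx gd]; split; first exact: differentiableD.
by move=> v Dv; rewrite (diffD fx gx) /= fd // gd.
Qed.

Lemma diff_alongB f g df dg :
  diff_along x D f df -> diff_along x D g dg ->
  diff_along x D (fun y => f y - g y) (fun v => df v - dg v).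
Proof.
move=> [fx fd] [gx gd]; split; first exact: differentiableB.
by move=> v Dv; rewrite (diffB fx gx) /= fd // gd.
Qed.

Lemma diff_alongM f g df dg :
  diff_along x D f df -> diff_along x D g dg ->
  diff_along x D (fun y => f y * g y) (fun v => df v * g x + f x * dg v).
Proof.
move=> [fx fd] [gx gd]; split; first exact: differentiableM.
move=> v Dv; rewrite (diffM fx gx) -[LHS]/(f x * 'd g x v + g x * 'd f x v).
by rewrite fd // gd // addrC [df v * _]mulrC.
Qed.

Lemma diff_along_cst (c : R) : diff_along x D (fun=> c) (fun=> 0).
Proof.
split; first exact: differentiable_cst.
by move=> v _; rewrite (diff_cst c x).
Qed.

Lemma diff_along_comp2 (G : R * R -> R) f g df dg :
  diff_along x D f df -> diff_along x D g dg ->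
  differentiable G (f x, g x) ->
  diff_along x D (fun y => G (f y, g y))
    (fun v => df v * 'D_(1, 0) G (f x, g x) + dg v * 'D_(0, 1) G (f x, g x)).
Proof.
move=> [fx fd] [gx gd] Gx.
have px := differentiable_pair fx gx.
split; first exact: (differentiable_comp px Gx).
move=> v Dv; rewrite (diff_comp px Gx) /= (diff_pair fx gx) fd // gd //.
rewrite !deriveE //.
have -> : (df v, dg v) = df v *: ((1, 0) : R * R) + dg v *: ((0, 1) : R * R).
  by congr pair; rewrite /= ?scaler0 ?addr0 ?add0r /GRing.scale /= mulr1.
by rewrite linearD !linearZ.
Qed.

End DiffAlong.

(** Locality is essential: the coefficients are only known to be smooth for R^2 > 0, so the explicit
    formula for [sgrad H] holds merely near the equilibrium. *)
Lemma near_diff_along (R : numFieldType) (V W : normedModType R) (x : V)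
    (D : V -> Prop) (f g df : V -> W) :
  (\forall y \near x, f y = g y) -> diff_along x D f df -> diff_along x D g df.
Proof.
move=> fg [fx fd]; have gx := near_eq_differentiable fg fx; split=> // v Dv.
by rewrite -fd // -!deriveE //; apply/esym/near_eq_derive.
Qed.

Lemma diff_along_mx (R : realFieldType) (V : normedModType R) (x : V)
    (D : V -> Prop) n (f df : V -> 'rV[R]_n) :
  (forall j, diff_along x D (fun y => f y 0 j) (fun v => df v 0 j)) ->
  diff_along x D f df.
Proof.
move=> fj.
have fx : differentiable f x.
  have -> : f = \sum_j (fun y => f y 0 j *: (delta_mx 0 j : 'rV[R]_n)).
    by apply/funext => y; rewrite fct_sumE; exact: row_sum_delta.
  by apply: differentiable_sum => j; apply: differentiableZl; case: (fj j).
split=> // v Dv; rewrite -deriveE // derive_mx; last exact: diff_derivable.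
by apply/rowP => j; rewrite !mxE; case: (fj j) => fjx /(_ v Dv) <-; rewrite deriveE.
Qed.

Lemma diff_along_coord (R : realType) n (x : 'rV[R]_n) (D : _ -> Prop) j :
  diff_along x D (fun y : 'rV[R]_n => y 0 j) (fun v => v 0 j).
Proof.
split; first exact: differentiable_coord.
move=> v _; rewrite -deriveE; last exact: differentiable_coord.
have := derive_mx (@derivable_id _ _ x v); rewrite derive_id => /rowP/(_ j).
by rewrite mxE.
Qed.

(** * Hamiltonian vector fields in coordinates *)

Definition iS (j : 'I_3) : 'I_6 := lshift 3 j.
Definition iR (j : 'I_3) : 'I_6 := rshift 3 j.
Definition eS (R : realType) (j : 'I_3) : 'rV[R]_6 := delta_mx 0 (iS j).
Definition eR (R : realType) (j : 'I_3) : 'rV[R]_6 := delta_mx 0 (iR j).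

Section Coordinates.
Context {R : realType}.
Implicit Types (x y v P : 'rV[R]_6) (D : 'rV[R]_6 -> Prop).

Lemma S1E : @S1 R = fun x => x 0 (iS 0).
Proof. by apply/funext => x; rewrite /S1 !mxE. Qed.
Lemma S2E : @S2 R = fun x => x 0 (iS 1).
Proof. by apply/funext => x; rewrite /S2 !mxE. Qed.
Lemma S3E : @S3 R = fun x => x 0 (iS ord_max).
Proof. by apply/funext => x; rewrite /S3 !mxE. Qed.
Lemma R1E : @R1 R = fun x => x 0 (iR 0).
Proof. by apply/funext => x; rewrite /R1 !mxE. Qed.
Lemma R2E : @R2 R = fun x => x 0 (iR 1).
Proof. by apply/funext => x; rewrite /R2 !mxE. Qed.
Lemma R3E : @R3 R = fun x => x 0 (iR ord_max).
Proof. by apply/funext => x; rewrite /R3 !mxE. Qed.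

Definition coordE := (S1E, S2E, S3E, R1E, R2E, R3E).

Lemma ord3P (i : 'I_3) : [\/ i = 0, i = 1 | i = ord_max].
Proof.
case: i => [[|[|[|//]]] ilt]; [constructor 1|constructor 2|constructor 3];
  exact: val_inj.
Qed.

Lemma coord_ind (Q : 'I_6 -> Prop) :
  Q (iS 0) -> Q (iS 1) -> Q (iS ord_max) ->
  Q (iR 0) -> Q (iR 1) -> Q (iR ord_max) -> forall i, Q i.
Proof.
move=> ? ? ? ? ? ? i.
by case: (@split_ordP 3 3 i) => j ->; case: (ord3P j) => ->.
Qed.

Lemma coordP x y : S1 x = S1 y -> S2 x = S2 y -> S3 x = S3 y ->
  R1 x = R1 y -> R2 x = R2 y -> R3 x = R3 y -> x = y.
Proof. by rewrite !coordE => *; apply/rowP; exact: coord_ind. Qed.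

Lemma big_ord3 (f : 'I_3 -> R) : \sum_(i < 3) f i = f 0 + f 1 + f ord_max.
Proof.
by rewrite !big_ord_recl big_ord0 addr0 addrA; congr (f _ + f _ + f _); exact: val_inj.
Qed.

Lemma F1E x : F1 x = R1 x ^+ 2 + R2 x ^+ 2 + R3 x ^+ 2.
Proof. by rewrite /F1 /dot3 big_ord3 !expr2. Qed.

Lemma F2E x : F2 x = S1 x * R1 x + S2 x * R2 x + S3 x * R3 x.
Proof. by rewrite /F2 /dot3 big_ord3. Qed.

(** This is the i-th component of the cross product u x v, with indices modulo 3. *)
Lemma eps_mxE (v : 'rV[R]_3) (i : 'I_3) (u : 'I_3 -> R) :
  \sum_(j < 3) eps_mx v i j * u j =
    v 0 (i + 1 + 1) * u (i + 1) - v 0 (i + 1) * u (i + 1 + 1).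
Proof.
have e2 : 1 + 1 = ord_max :> 'I_3 by exact: val_inj.
have e3 : ord_max + 1 = 0 :> 'I_3 by exact: val_inj.
by case: (ord3P i) => ->; rewrite big_ord3 !mxE !big_ord3 /levi_civita /= ?add0r
  ?(e2, e3, add0r) ?(e2, e3, add0r); ring.
Qed.

Lemma sgradE f x i : sgrad f x 0 i =
  \sum_(j < 6) poisson_mx x i j * 'D_(delta_mx 0 j) f x.
Proof.
have coordD k : 'D_(delta_mx 0 k) (fun y : 'rV[R]_6 => y 0 i) x = (i == k)%:R.
  have [fx fd] := diff_along_coord x (fun=> True) i.
  by rewrite (deriveE _ fx) fd // mxE eqxx.
rewrite mxE /bracket (bigD1 i) //= [X in _ + X]big1 => [|k ki].
  by rewrite addr0; apply: eq_bigr => j _; rewrite coordD eqxx mulr1.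
apply: big1 => j _.
by rewrite coordD eq_sym (negPf ki) mulr0 mul0r.
Qed.

Lemma sgradS f x i : sgrad f x 0 (iS i) =
  \sum_(j < 3) eps_mx (Svec x) i j * 'D_(eS R j) f x +
  \sum_(j < 3) eps_mx (Rvec x) i j * 'D_(eR R j) f x.
Proof.
rewrite sgradE (@big_split_ord _ _ _ 3 3) /=; congr (_ + _); apply: eq_bigr => j _.
  by congr (_ * _); exact: (@block_mxEul _ 3 3 3 3).
by congr (_ * _); exact: (@block_mxEur _ 3 3 3 3).
Qed.

Lemma sgradR f x i : sgrad f x 0 (iR i) =
  \sum_(j < 3) eps_mx (Rvec x) i j * 'D_(eS R j) f x.
Proof.
rewrite sgradE (@big_split_ord _ _ _ 3 3) /= [X in _ + X]big1 ?addr0.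
  by apply: eq_bigr => j _; congr (_ * _); exact: (@block_mxEdl _ 3 3 3 3).
by move=> j _; rewrite [poisson_mx _ _ _](@block_mxEdr _ 3 3 3 3) mxE mul0r.
Qed.

Definition vec6 (s1 s2 s3 r1 r2 r3 : R) : 'rV[R]_6 :=
  \row_(i < 6) [:: s1; s2; s3; r1; r2; r3]`_i.

Lemma vec6E s1 s2 s3 r1 r2 r3 : let v := vec6 s1 s2 s3 r1 r2 r3 in
  (S1 v = s1) * (S2 v = s2) * (S3 v = s3) *
  (R1 v = r1) * (R2 v = r2) * (R3 v = r3).
Proof. by rewrite /= !coordE !mxE. Qed.

Lemma basisE : (S1 (eS R 0) = 1) * (S1 (eS R 1) = 0) * (S1 (eS R ord_max) = 0) *
  (S1 (eR R 0) = 0) * (S1 (eR R 1) = 0) * (S1 (eR R ord_max) = 0) *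
  (S2 (eS R 0) = 0) * (S2 (eS R 1) = 1) * (S2 (eS R ord_max) = 0) *
  (S2 (eR R 0) = 0) * (S2 (eR R 1) = 0) * (S2 (eR R ord_max) = 0) *
  (S3 (eS R 0) = 0) * (S3 (eS R 1) = 0) * (S3 (eS R ord_max) = 1) *
  (S3 (eR R 0) = 0) * (S3 (eR R 1) = 0) * (S3 (eR R ord_max) = 0) *
  (R1 (eS R 0) = 0) * (R1 (eS R 1) = 0) * (R1 (eS R ord_max) = 0) *
  (R1 (eR R 0) = 1) * (R1 (eR R 1) = 0) * (R1 (eR R ord_max) = 0) *
  (R2 (eS R 0) = 0) * (R2 (eS R 1) = 0) * (R2 (eS R ord_max) = 0) *
  (R2 (eR R 0) = 0) * (R2 (eR R 1) = 1) * (R2 (eR R ord_max) = 0) *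
  (R3 (eS R 0) = 0) * (R3 (eS R 1) = 0) * (R3 (eS R ord_max) = 0) *
  (R3 (eR R 0) = 0) * (R3 (eR R 1) = 0) * (R3 (eR R ord_max) = 1).
Proof. by do !split; rewrite !coordE mxE. Qed.

(* The Hamiltonian vector field at x of a function with differential d at x. *)
Definition ham_field x (d : 'rV[R]_6 -> R) : 'rV[R]_6 :=
  vec6 (S3 x * d (eS R 1) - S2 x * d (eS R ord_max)
          + (R3 x * d (eR R 1) - R2 x * d (eR R ord_max)))
       (S1 x * d (eS R ord_max) - S3 x * d (eS R 0)
          + (R1 x * d (eR R ord_max) - R3 x * d (eR R 0)))
       (S2 x * d (eS R 0) - S1 x * d (eS R 1)
          + (R2 x * d (eR R 0) - R1 x * d (eR R 1)))
       (R3 x * d (eS R 1) - R2 x * d (eS R ord_max))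
       (R1 x * d (eS R ord_max) - R3 x * d (eS R 0))
       (R2 x * d (eS R 0) - R1 x * d (eS R 1)).

Lemma sgrad_field f x : sgrad f x = ham_field x (fun v => 'D_v f x).
Proof.
have e2 : 1 + 1 = ord_max :> 'I_3 by exact: val_inj.
have e3 : ord_max + 1 = 0 :> 'I_3 by exact: val_inj.
by apply: coordP; rewrite vec6E coordE ?sgradS ?sgradR !eps_mxE
  ?(e2, e3, add0r) ?(e2, e3, add0r).
Qed.

Lemma diff_along_vec6 P D (a1 a2 a3 a4 a5 a6 d1 d2 d3 d4 d5 d6 : _ -> R) :
  diff_along P D a1 d1 -> diff_along P D a2 d2 -> diff_along P D a3 d3 ->
  diff_along P D a4 d4 -> diff_along P D a5 d5 -> diff_along P D a6 d6 ->
  diff_along P D (fun x => vec6 (a1 x) (a2 x) (a3 x) (a4 x) (a5 x) (a6 x))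
    (fun v => vec6 (d1 v) (d2 v) (d3 v) (d4 v) (d5 v) (d6 v)).
Proof.
have comp (b e b' e' : _ -> R) : (forall x, b' x = b x) ->
    (forall v, e v = e' v) -> diff_along P D b e -> diff_along P D b' e'.
  by move=> /funext -> /funext ->.
move=> h1 h2 h3 h4 h5 h6; apply: diff_along_mx; apply: coord_ind;
  [apply: comp h1|apply: comp h2|apply: comp h3
  |apply: comp h4|apply: comp h5|apply: comp h6] => // v; by rewrite mxE.
Qed.

Lemma vec6D s1 s2 s3 r1 r2 r3 s1' s2' s3' r1' r2' r3' :
  vec6 s1 s2 s3 r1 r2 r3 + vec6 s1' s2' s3' r1' r2' r3' =
  vec6 (s1 + s1') (s2 + s2') (s3 + s3') (r1 + r1') (r2 + r2') (r3 + r3').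
Proof. by apply/rowP; apply: coord_ind; rewrite !mxE. Qed.

Lemma diff_along_S1 P D : diff_along P D (@S1 R) (@S1 R).
Proof. by rewrite coordE; exact: diff_along_coord. Qed.
Lemma diff_along_S2 P D : diff_along P D (@S2 R) (@S2 R).
Proof. by rewrite coordE; exact: diff_along_coord. Qed.
Lemma diff_along_S3 P D : diff_along P D (@S3 R) (@S3 R).
Proof. by rewrite coordE; exact: diff_along_coord. Qed.
Lemma diff_along_R1 P D : diff_along P D (@R1 R) (@R1 R).
Proof. by rewrite coordE; exact: diff_along_coord. Qed.
Lemma diff_along_R2 P D : diff_along P D (@R2 R) (@R2 R).
Proof. by rewrite coordE; exact: diff_along_coord. Qed.
Lemma diff_along_R3 P D : diff_along P D (@R3 R) (@R3 R).
Proof. by rewrite coordE; exact: diff_along_coord. Qed.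

End Coordinates.

Ltac solve_diff_along :=
  repeat first [exact: diff_along_S1 | exact: diff_along_S2
    | exact: diff_along_S3 | exact: diff_along_R1 | exact: diff_along_R2
    | exact: diff_along_R3 | exact: diff_along_cst
    | apply: diff_alongB | apply: diff_alongD | apply: diff_alongM].

(** Product rule for [ham_field], which is bilinear in the point and the differential. The term
    [ham_field v (df P)] survives even at an equilibrium: the Poisson structure is degenerate, so df
    itself may be a non-zero combination of the differentials of the Casimirs. *)
Lemma diff_along_sgrad (R : realType) (P : 'rV[R]_6) D f
    (df h : 'rV[R]_6 -> 'rV[R]_6 -> R) :
  (\forall x \near P, forall v, 'D_v f x = df x v) ->
  (forall e, diff_along P D (df ^~ e) (h ^~ e)) ->
  diff_along P D (sgrad f) (fun v => ham_field v (df P) + ham_field P (h v)).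
Proof.
move=> fd dh; apply: (near_diff_along (f := fun x => ham_field x (df x))).
  apply: filterS fd => x fx; rewrite sgrad_field; congr ham_field.
  by apply/funext => v; rewrite fx.
apply: diff_along_eq.
  by apply: diff_along_vec6; repeat first [exact: dh | progress solve_diff_along].
by move=> v _; rewrite vec6D; congr vec6; ring.
Qed.

Lemma partial2E (R : realType) (f : R * R -> R) r z :
  partial2 f r z = 'D_(0, 1) f (r, z).
Proof.
rewrite /partial2 /derive1 /derive.
set a := (fun h : R => _); set b := (fun h : R => _).
suff -> : a = b by [].
apply/funext => h; rewrite /a /b /=.
congr (_ *: (f _ - _)).
by rewrite -[RHS]/(h * 0 + r, h * 1 + z) mulr0 add0r mulr1.
Qed.

Definition twice_differentiable (R : realType) (V : normedModType R) (f : V -> R)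
    (x : V) :=
  differentiable f x /\ forall v, differentiable ('D_v f) x.

Lemma smooth_twice_differentiable (R : realType) (V : normedModType R)
    (U : set V) (f : V -> R) x :
  smooth_on U f -> U x -> twice_differentiable f x.
Proof. by move=> /(_ 2)[f1 f2] Ux; split=> [|v]; [exact: f1|exact: (f2 v).1]. Qed.

(** * First and second differentials of the Hamiltonian along the leaf *)

Section Hamiltonian.
Context {R : realType}.
Implicit Types (x v e P : 'rV[R]_6) (G : R * R -> R).
Local Notation phi x := (F1 x, R3 x).
Local Notation D1 G x := ('D_(1, 0) G (phi x)).
Local Notation D2 G x := ('D_(0, 1) G (phi x)).

(* In dF1 x e, dF2 x e, dH x e, etc., e is the direction; in hessH P v e the
   differential in direction e is differentiated once more along v. *)
Definition dF1 x e := 2 * (R1 x * R1 e + R2 x * R2 e + R3 x * R3 e).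
Definition dF2 x e := S1 x * R1 e + S1 e * R1 x + S2 x * R2 e + S2 e * R2 x
  + S3 x * R3 e + S3 e * R3 x.

Lemma diff_along_F1 P D : diff_along P D (@F1 R) (dF1 P).
Proof.
rewrite (_ : @F1 R = fun x => R1 x * R1 x + R2 x * R2 x + R3 x * R3 x).
  by apply: diff_along_eq; [solve_diff_along | rewrite /dF1 => v _; ring].
by apply/funext => x; rewrite F1E !expr2.
Qed.

Lemma diff_along_F2 P D : diff_along P D (@F2 R) (dF2 P).
Proof.
rewrite (_ : @F2 R = fun x => S1 x * R1 x + S2 x * R2 x + S3 x * R3 x).
  by apply: diff_along_eq; [solve_diff_along | rewrite /dF2 => v _; ring].
by apply/funext => x; rewrite F2E.
Qed.

Lemma diff_along_casimir G P D : differentiable G (phi P) ->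
  diff_along P D (fun x => G (phi x))
    (fun v => dF1 P v * D1 G P + R3 v * D2 G P).
Proof. by apply: diff_along_comp2; [exact: diff_along_F1|exact: diff_along_R3]. Qed.

(** All terms of H after the quadratic one have the shape G(R^2, R_3) w, with w one of [crossSR],
    [F2], [S3], 1; one product rule serves all four. *)
Definition dcasimir_term G (w : 'rV[R]_6 -> R) (dw : 'rV[R]_6 -> 'rV[R]_6 -> R) x e :=
  (dF1 x e * D1 G x + R3 e * D2 G x) * w x + G (phi x) * dw x e.

Lemma diff_along_casimir_term G w dw P D :
  differentiable G (phi P) -> diff_along P D w (dw P) ->
  diff_along P D (fun x => G (phi x) * w x) (dcasimir_term G w dw P).
Proof. by move=> /diff_along_casimir-/(_ D) Gd wd; exact: diff_alongM Gd wd. Qed.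

(** The tangent space of the leaf at any point of the axis with R_3 != 0: there dF_1 = 2 R_3 dR_3
    and dF_2 = S_3 dR_3 + R_3 dS_3. *)
Definition tangent v := S3 v = 0 /\ R3 v = 0.

(** On the axis both R^2 and R_3 are stationary along the leaf. Applied to the partial derivatives
    of a coefficient as well, this removes its second derivatives. *)
Lemma diff_along_casimir_tangent G P : R1 P = 0 -> R2 P = 0 ->
  differentiable G (phi P) -> diff_along P tangent (fun x => G (phi x)) (fun=> 0).
Proof.
move=> P1 P2 Gd; apply: diff_along_eq (diff_along_casimir tangent Gd) _.
by move=> v [_ v3]; rewrite /dF1 P1 P2 v3; ring.
Qed.

(** As R^2, R_3 and w are stationary along the leaf, G is differentiated only through the second
    differential of R^2; R_3 is linear and contributes nothing. *)
Definition hess_casimir_term G (w : 'rV[R]_6 -> R) (ddw : 'rV[R]_6 -> 'rV[R]_6 -> R)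
    P v e :=
  2 * (R1 v * R1 e + R2 v * R2 e) * D1 G P * w P + G (phi P) * ddw v e.

Lemma diff_along_dcasimir_term G w dw ddw P e :
  R1 P = 0 -> R2 P = 0 -> twice_differentiable G (phi P) ->
  diff_along P tangent w (fun=> 0) ->
  diff_along P tangent (dw ^~ e) (ddw ^~ e) ->
  diff_along P tangent (dcasimir_term G w dw ^~ e) (hess_casimir_term G w ddw P ^~ e).
Proof.
move=> P4 P5 [Gd Gdd] wd dwd.
have {}Gd := diff_along_casimir_tangent P4 P5 Gd.
have Gx := diff_along_casimir_tangent P4 P5 (Gdd (1, 0)).
have Gz := diff_along_casimir_tangent P4 P5 (Gdd (0, 1)).
have dF1d : diff_along P tangent (dF1 ^~ e)
    (fun v => 2 * (R1 v * R1 e + R2 v * R2 e)).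
  rewrite /dF1; apply: diff_along_eq; first by solve_diff_along.
  by move=> v [_ ->]; ring.
rewrite /dcasimir_term; apply: diff_along_eq.
  apply: diff_alongD (diff_alongM Gd dwd).
  apply: diff_alongM wd; apply: (diff_alongD (diff_alongM dF1d Gx)).
  exact: (diff_alongM (diff_along_cst _ _ (R3 e)) Gz).
by move=> v _; rewrite /hess_casimir_term; ring.
Qed.

Definition crossSR x := S1 x * R2 x - S2 x * R1 x.
Definition dcrossSR x e := S1 x * R2 e + S1 e * R2 x - S2 x * R1 e - S2 e * R1 x.

Lemma diff_along_crossSR P D : diff_along P D crossSR (dcrossSR P).
Proof.
apply: diff_along_eq; first by rewrite /crossSR; solve_diff_along.
by rewrite /dcrossSR => v _; ring.
Qed.

Definition dH (beta : R) (g1 g2 g3 V : R * R -> R) x e : R :=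
  S1 x * S1 e + S2 x * S2 e + S3 x * S3 e * beta^-1
  + dcasimir_term g1 crossSR dcrossSR x e + dcasimir_term g2 (@F2 R) dF2 x e
  + dcasimir_term g3 (@S3 R) (fun=> @S3 R) x e
  + dcasimir_term V (fun=> 1) (fun _ _ => 0) x e.

Lemma derive_hamiltonian beta g1 g2 g3 V x e :
  differentiable g1 (phi x) -> differentiable g2 (phi x) ->
  differentiable g3 (phi x) -> differentiable V (phi x) ->
  'D_e (hamiltonian beta g1 g2 g3 V) x = dH beta g1 g2 g3 V x e.
Proof.
move=> g1d g2d g3d Vd; set H := hamiltonian _ _ _ _ _; pose D (_ : 'rV[R]_6) := True.
have [Hd Hv] : diff_along x D H (dH beta g1 g2 g3 V x).
  have -> : H = fun y => 2^-1 * (S1 y * S1 y + S2 y * S2 y +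
      S3 y * S3 y * beta^-1) + g1 (phi y) * crossSR y
      + g2 (phi y) * F2 y + g3 (phi y) * S3 y + V (phi y) * 1.
    by apply/funext => y; rewrite /H /hamiltonian !expr2 mulr1.
  rewrite /dH; apply: diff_alongD.
    apply: diff_alongD.
      apply: diff_alongD.
        apply: diff_alongD.
          apply: diff_along_eq; first by solve_diff_along.
          by move=> v _ /=; move: beta^-1 => b; field.
        exact: diff_along_casimir_term (diff_along_crossSR _ _).
      exact: diff_along_casimir_term (diff_along_F2 _ _).
    exact: diff_along_casimir_term (diff_along_S3 _ _).
  apply: (diff_along_casimir_term (w := fun=> 1) (dw := fun _ _ => 0)) => //.
  exact: diff_along_cst.
by rewrite (deriveE _ Hd) Hv.
Qed.

(** [crossSR] and [F2] are quadratic forms, so the bilinear [dcrossSR] and [dF2] serve also as their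
    Hessians. The term in 1 / beta is absent because S_3 vanishes on tangent v. *)
Definition hessH (g1 g2 g3 V : R * R -> R) P v e : R :=
  S1 v * S1 e + S2 v * S2 e
  + hess_casimir_term g1 crossSR dcrossSR P v e + hess_casimir_term g2 (@F2 R) dF2 P v e
  + hess_casimir_term g3 (@S3 R) (fun _ _ => 0) P v e
  + hess_casimir_term V (fun=> 1) (fun _ _ => 0) P v e.

Lemma diff_along_dH beta g1 g2 g3 V P e :
  S1 P = 0 -> S2 P = 0 -> R1 P = 0 -> R2 P = 0 ->
  twice_differentiable g1 (phi P) -> twice_differentiable g2 (phi P) ->
  twice_differentiable g3 (phi P) -> twice_differentiable V (phi P) ->
  diff_along P tangent (dH beta g1 g2 g3 V ^~ e) (hessH g1 g2 g3 V P ^~ e).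
Proof.
move=> P1 P2 P4 P5 g1d g2d g3d Vd.
rewrite /dH /hessH; apply: diff_alongD.
  apply: diff_alongD.
    apply: diff_alongD.
      apply: diff_alongD.
        apply: diff_along_eq; first by solve_diff_along.
        by move=> v [-> _]; ring.
      apply: diff_along_dcasimir_term => //.
        apply: diff_along_eq (diff_along_crossSR P tangent) _ => v _.
        by rewrite /dcrossSR P1 P2 P4 P5; ring.
      rewrite /dcrossSR; apply: diff_along_eq; first by solve_diff_along.
      by move=> v _ /=; ring.
    apply: diff_along_dcasimir_term => //.
      apply: diff_along_eq (diff_along_F2 P tangent) _ => v [v3 v6].
      by rewrite /dF2 P1 P2 P4 P5 v3 v6; ring.
    rewrite /dF2; apply: diff_along_eq; first by solve_diff_along.
    by move=> v [v3 v6] /=; ring.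
  apply: diff_along_dcasimir_term => //; last exact: diff_along_cst.
  by apply: diff_along_eq (diff_along_S3 P tangent) _ => v [].
by apply: diff_along_dcasimir_term => //; exact: diff_along_cst.
Qed.
End Hamiltonian.

(** * Linearizations at an equilibrium on the axis *)

Section Equilibrium.
Context {R : realType}.
Implicit Types (x v e P : 'rV[R]_6).

Lemma mulmx_jacobian n P D (f df : 'rV[R]_6 -> 'rV[R]_n) v :
  diff_along P D f df -> D v -> v *m jacobian f P = df v.
Proof. by move=> [_ fd] Dv; rewrite /jacobian mul_rV_lin1 fd. Qed.

(* The order S_1, R_1, S_2, R_2 puts the real parts of (z, w) before the imaginary
   parts, as in realify. *)
Definition plane_index (k : nat) : 'I_6 := nth (iS 0) [:: iS 0; iR 0; iS 1; iR 1] k.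

Definition plane_mx : 'M[R]_(2 + 2, 6) :=
  \matrix_(k < 2 + 2) delta_mx 0 (plane_index k).

Lemma plane_mx_free : row_free plane_mx.
Proof.
(* The rows are distinct standard basis vectors, hence orthonormal, and the transpose is a right
   inverse. *)
apply/row_freeP; exists plane_mx^T; apply/matrixP => j k.
transitivity ((row j plane_mx *m (row k plane_mx)^T) 0 0).
  by rewrite tr_row !mxE; apply: eq_bigr => l _; rewrite !mxE.
rewrite !rowK trmx_delta mul_delta_mx_cond mulmxnE !mxE eqxx /=.
by rewrite /plane_index nth_uniq.
Qed.

Lemma sub_plane_mx v : (v <= plane_mx)%MS <-> tangent v.
Proof.
split.
  case/submxP => u ->; rewrite mulmx_sum_row /tangent !coordE !summxE.
  by split; apply: big1 => k _; rewrite mxE rowK mxE;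
    case: k => [[|[|[|[|]]]] kl] //=; rewrite mulr0.
move=> [v3 v6].
have -> : v = S1 v *: eS R 0 + R1 v *: eR R 0 + S2 v *: eS R 1 + R2 v *: eR R 1.
  apply/rowP; rewrite !coordE in v3 v6 *; apply: coord_ind;
    rewrite !mxE ?v3 ?v6 /= ?mulr0 ?mulr1 ?addr0 ?add0r //.
have sub (k : 'I_(2 + 2)) :
    ((delta_mx 0 (plane_index k) : 'rV[R]_6) <= plane_mx)%MS.
  have <- : row k plane_mx = delta_mx 0 (plane_index k) by rewrite rowK.
  exact: row_sub.
by rewrite !addmx_sub // scalemx_sub //; [exact: (sub (@Ordinal 4 0 isT))
  |exact: (sub (@Ordinal 4 1 isT))|exact: (sub (@Ordinal 4 2 isT))
  |exact: (sub (@Ordinal 4 3 isT))].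
Qed.

Lemma leaf_tangentE P : S1 P = 0 -> S2 P = 0 -> R1 P = 0 -> R2 P = 0 ->
  R3 P != 0 -> (leaf_tangent P :=: plane_mx)%MS.
Proof.
move=> P1 P2 P4 P5 P6.
set F := fun y : 'rV[R]_6 => \row_(i < 2) [:: F1 y; F2 y]`_i.
have dF : diff_along P (fun=> True) F (fun v => \row_(i < 2) [:: dF1 P v; dF2 P v]`_i).
  apply: diff_along_mx => i.
  case: i => [[|[|//]] ilt].
  - apply: (near_diff_along (f := @F1 R)).
      by apply: filterE => y; rewrite mxE.
    by apply: diff_along_eq (diff_along_F1 _ _) _ => v _; rewrite mxE.
  - apply: (near_diff_along (f := @F2 R)).
      by apply: filterE => y; rewrite mxE.
    by apply: diff_along_eq (diff_along_F2 _ _) _ => v _; rewrite mxE.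
have kerE v : (v <= leaf_tangent P)%MS <-> tangent v.
  rewrite /leaf_tangent; split.
    move=> /sub_kermxP; rewrite (mulmx_jacobian dF) // => /rowP vF.
    move: (vF 0) (vF 1); rewrite !mxE /= /dF1 /dF2 P1 P2 P4 P5.
    rewrite !mul0r !mulr0 !add0r => /eqP; rewrite !mulf_eq0 pnatr_eq0 /= (negPf P6) /=.
    move=> /eqP v6; rewrite v6 mulr0 add0r => /eqP.
    by rewrite mulf_eq0 (negPf P6) orbF => /eqP v3.
  move=> [v3 v6]; apply/sub_kermxP; rewrite (mulmx_jacobian dF) //.
  apply/rowP => i; rewrite !mxE /dF1 /dF2 P1 P2 P4 P5 v3 v6.
  by case: i => [[|[|//]] ilt] /=; ring.
by apply/eqmxP/andP; split; apply/rV_subP => v; rewrite -?sub_plane_mx;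
  [move=> /kerE/sub_plane_mx|move=> /sub_plane_mx/kerE].
Qed.

Definition complex_act (M : 'M[R[i]]_2) v : 'rV[R]_6 :=
  let z := S1 v +i* S2 v in let w := R1 v +i* R2 v in
  vec6 (complex.Re (z * M 0 0 + w * M 1 0)) (complex.Im (z * M 0 0 + w * M 1 0)) 0
       (complex.Re (z * M 0 1 + w * M 1 1)) (complex.Im (z * M 0 1 + w * M 1 1)) 0.

Lemma plane_mx_realify (J : 'M[R]_6) (M : 'M[R[i]]_2) :
  (forall v, tangent v -> v *m J = complex_act M v) ->
  plane_mx *m J = realify M *m plane_mx.
Proof.
move=> JM; apply/row_matrixP => k; rewrite !row_mul JM; last first.
  by apply/sub_plane_mx; rewrite row_sub.
have big2 (V : zmodType) (F : 'I_2 -> V) : \sum_(l < 2) F l = F 0 + F 1.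
  by rewrite !big_ord_recl big_ord0 addr0; congr (F _ + F _); exact: val_inj.
rewrite rowK mulmx_sum_row (@big_split_ord _ _ _ 2 2) /= !big2 !rowK /realify.
have ord2P (l : 'I_2) : l = 0 \/ l = 1.
  by case: l => [[|[|//]] ?]; [left|right]; exact: val_inj.
case: (split_ordP k) => l -> {k}; rewrite ![row _ _ _ _]mxE;
  rewrite ?(block_mxEul, block_mxEur, block_mxEdl, block_mxEdr) !mxE;
  case: (ord2P l) => ->; apply/rowP; apply: coord_ind;
  rewrite /complex_act !coordE !mxE /= ?(mulr0, mulr1, addr0, add0r, subr0) //;
  case: (M _ _) => p q; case: (M _ _) => p' q' /=; ring.
Qed.

Lemma coords_zero : (S1 (0 : 'rV[R]_6) = 0) * (S2 (0 : 'rV[R]_6) = 0) *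
  (S3 (0 : 'rV[R]_6) = 0) * (R1 (0 : 'rV[R]_6) = 0) *
  (R2 (0 : 'rV[R]_6) = 0) * (R3 (0 : 'rV[R]_6) = 0).
Proof. by do !split; rewrite !coordE mxE. Qed.

Section Axis.
Variables (beta : R) (g1 g2 g3 V : R * R -> R) (P : 'rV[R]_6).
Hypotheses (P1 : S1 P = 0) (P2 : S2 P = 0) (P4 : R1 P = 0) (P5 : R2 P = 0).
Let p := (F1 P, R3 P).

(* Derivative in direction u of the effective potential V + g g_2 + S_3 g_3, with
   the Casimir F_2 = g and the integral S_3 held fixed. *)
Definition dVeff (u : R * R) : R :=
  F2 P * 'D_u g2 p + S3 P * 'D_u g3 p + 'D_u V p.
(** The partial derivative of H with respect to S_3 at P. *)
Definition spin : R := S3 P * beta^-1 + g2 p * R3 P + g3 p.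

Lemma dH_axis e : dH beta g1 g2 g3 V P e = spin * S3 e +
  (2 * R3 P * dVeff (1, 0) + dVeff (0, 1) + g2 p * S3 P) * R3 e.
Proof.
have -> : dH beta g1 g2 g3 V P e = S3 P * S3 e * beta^-1 +
    dF1 P e * dVeff (1, 0) + R3 e * dVeff (0, 1) + g2 p * dF2 P e + g3 p * S3 e.
  rewrite /dH /dcasimir_term /crossSR /dcrossSR /dVeff P1 P2 P4 P5 -/p.
  move: (g1 p) (g2 p) (g3 p) (V p) ('D_(1, 0) g1 p) ('D_(1, 0) g2 p)
    ('D_(1, 0) g3 p) ('D_(1, 0) V p) ('D_(0, 1) g1 p) ('D_(0, 1) g2 p)
    ('D_(0, 1) g3 p) ('D_(0, 1) V p) => *.
  by ring.
by rewrite /dF1 /dF2 P1 P2 P4 P5 /spin; ring.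
Qed.

Lemma hessH_axis v e : tangent v -> hessH g1 g2 g3 V P v e =
  S1 v * S1 e + S2 v * S2 e + g1 p * dcrossSR v e
  + g2 p * (S1 v * R1 e + S1 e * R1 v + S2 v * R2 e + S2 e * R2 v)
  + 2 * dVeff (1, 0) * (R1 v * R1 e + R2 v * R2 e).
Proof.
move=> [v3 v6]; rewrite /hessH /hess_casimir_term /dVeff /dF2 /crossSR.
rewrite P1 P2 P4 P5 v3 v6 -/p.
by ring.
Qed.

(** On the axis the differential of H involves only dS_3 and dR_3, and these enter the Hamiltonian
    field multiplied by S_1, S_2, R_1 or R_2, which vanish at P. *)
Lemma ham_field_dH : ham_field P (dH beta g1 g2 g3 V P) = 0.
Proof.
rewrite /ham_field !dH_axis !basisE P1 P2 P4 P5.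
move: spin (dVeff _) (dVeff _) (g2 p) => o d1 d2 c.
by apply: coordP; rewrite vec6E ?coords_zero; ring.
Qed.

(** Matrices act on the row (z, w): the first column gives the derivative of z, the second that of
    w. The terms in [g2 p] cancel against the one inside [spin], as [F2] is a Casimir. *)
Definition complexH : 'M[R[i]]_2 :=
  \matrix_(i < 2, j < 2) nth 0 (nth [::]
    [:: [:: (R3 P * g1 p) +i* (spin - S3 P - R3 P * g2 p); 0 +i* (- R3 P)];
        [:: (- S3 P * g1 p) +i* dVeff (0, 1);
            (- R3 P * g1 p) +i* (spin - R3 P * g2 p)]] i) j.

(** The two occurrences of [dVeff (1, 0)], one from [dH_axis] and one from [hessH_axis], together
    form the linearization of the zero field sgrad F_1 times a constant, and so cancel. *)
Lemma linear_field v : tangent v ->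
  ham_field v (dH beta g1 g2 g3 V P) + ham_field P (hessH g1 g2 g3 V P v) =
  complex_act complexH v.
Proof.
move=> tv; rewrite /ham_field vec6D !dH_axis !hessH_axis // /complex_act !mxE /=.
rewrite /dcrossSR !basisE P1 P2 P4 P5; case: tv => -> ->.
move: spin (dVeff _) (dVeff _) (g1 p) (g2 p) => o d1 d2 c1 c2.
by congr vec6; ring.
Qed.
End Axis.

Lemma linear_field_S3 P v : ham_field v (@S3 R) + ham_field P (fun=> 0) =
  complex_act ('i)%:M v.
Proof.
rewrite /ham_field vec6D /complex_act !mxE /= !basisE.
by congr vec6; ring.
Qed.
End Equilibrium.

(** * Eigenvalues of lam A_H + mu A_K and the type of the point *)

Section Spectrum.
Context {R : realType}.
Variables (P : 'rV[R]_6) (H : 'rV[R]_6 -> R) (M : 'M[R[i]]_2).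
Hypotheses (P1 : S1 P = 0) (P2 : S2 P = 0) (P4 : R1 P = 0) (P5 : R2 P = 0).
Hypothesis (P6 : R3 P != 0).
Hypothesis linH : forall v, tangent v -> v *m jacobian (sgrad H) P = complex_act M v.
Let K := @S3 R.

Lemma derive_S3 x v : 'D_v K x = S3 v.
Proof.
have [Kd Kv] := diff_along_S3 x (fun=> True).
by rewrite (deriveE _ Kd) Kv.
Qed.

Lemma jacobian_sgrad_S3 v : v *m jacobian (sgrad K) P = complex_act ('i)%:M v.
Proof.
rewrite -(linear_field_S3 P) (mulmx_jacobian (D := fun=> True) (df :=
  fun v => ham_field v K + ham_field P (fun=> 0))) //.
apply: (diff_along_sgrad (df := fun=> K) (h := fun _ _ => 0)).
  by apply: filterE => x u; exact: derive_S3.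
by move=> e; exact: diff_along_cst.
Qed.

Lemma lin_comb_realify :
  exists (X : 'M[R]_(\rank (leaf_tangent P), 2 + 2))
         (Y : 'M[R]_(2 + 2, \rank (leaf_tangent P))),
    [/\ X *m Y = 1%:M, Y *m X = 1%:M,
        linearization H P = X *m realify M *m Y &
        linearization K P = X *m realify ('i)%:M *m Y].
Proof.
have [X [Y [XY YX lin]]] :=
  restrictmx_conj plane_mx_free (leaf_tangentE P1 P2 P4 P5 P6).
exists X, Y; split=> //; apply: lin; apply: plane_mx_realify => //.
by move=> v _; exact: jacobian_sgrad_S3.
Qed.

(** A_K corresponds to the scalar matrix i, whose real multiples have zero off-diagonal entries and
    hence never equal M. *)
Lemma free_linearizations : M 0 1 != 0 ->
  free [:: linearization H P; linearization K P].
Proof.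
have [X [Y [XY YX -> ->]]] := lin_comb_realify => M01.
have inj (A : 'M[R]_(2 + 2)) : Y *m (X *m A *m Y) *m X = A.
  by rewrite !mulmxA YX mul1mx -mulmxA YX mulmx1.
rewrite free_cons seq1_free span_seq1; apply/andP; split.
  apply: contra M01 => /vlineP[k] /(congr1 (fun A => Y *m A *m X)).
  rewrite -scalemxAr -scalemxAl !inj -realifyZ => /matrixP e.
  move: (e (lshift 2 0) (lshift 2 1)) (e (lshift 2 0) (rshift 2 1)).
  rewrite !block_mxEul !block_mxEur !mxE mulr0n mulr0 /= => re im.
  by rewrite eq_complex re im !eqxx.
apply/eqP => /(congr1 (fun A => Y *m A *m X)).
rewrite inj mulmx0 mul0mx => /matrixP/(_ (lshift 2 0) (rshift 2 0)).
by rewrite !block_mxEur !mxE /= => /eqP; rewrite oner_eq0.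
Qed.

Variables (omega q : R) (d : R[i]).
Hypotheses (M00 : M 0 0 = 0 +i* omega + d) (M11 : M 1 1 = 0 +i* omega - d).
Hypothesis Mq : d ^+ 2 + M 0 1 * M 1 0 = (- q)%:C.

Lemma ceigenvalue_lin_comb lam mu k :
  ceigenvalue (lin_comb H K P lam mu) k =
    ((k - 0 +i* (lam * omega + mu)) ^+ 2 == (- (lam ^+ 2 * q))%:C) ||
    ((k + 0 +i* (lam * omega + mu)) ^+ 2 == (- (lam ^+ 2 * q))%:C).
Proof.
have [X [Y [XY YX linHE linKE]]] := lin_comb_realify.
pose N := lam%:C *: M + mu%:C *: ('i)%:M.
have -> : lin_comb H K P lam mu = X *m realify N *m Y.
  rewrite /lin_comb linHE linKE realifyD !realifyZ mulmxDr mulmxDl.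
  by rewrite -!scalemxAr -!scalemxAl.
rewrite /ceigenvalue !map_mxM eigenvalue_conj -?map_mxM ?XY ?YX ?map_mx1 //.
apply: (@ceigenvalue_realify2 R N (lam%:C * d)).
- rewrite !mxE /= M00; apply/eqP; case: d => a b; rewrite eq_complex /=.
  by apply/andP; split; apply/eqP; ring.
- rewrite !mxE /= M11; apply/eqP; case: d => a b; rewrite eq_complex /=.
  by apply/andP; split; apply/eqP; ring.
rewrite !mxE /= mulr0n mulr0 !addr0.
have -> : (- (lam ^+ 2 * q))%:C = lam%:C ^+ 2 * (- q)%:C.
  by rewrite -mulrN rmorphM rmorphXn.
by rewrite -Mq; ring.
Qed.

Lemma nondegenerate_spectrum a g :
  M 0 1 != 0 -> rank0_point a g H K P ->
  (nondegenerate_rank0 a g H K P <-> q <> 0) /\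
  (nondegenerate_rank0 a g H K P ->
     (0 < q -> center_center a g H K P) /\ (q < 0 -> focus_focus a g H K P)).
Proof.
move=> M01 rk.
have nd lam mu : four_distinct_nonzero_eigenvalues (lin_comb H K P lam mu) ->
    nondegenerate_rank0 a g H K P.
  by move=> fd; split; [|exact: free_linearizations|exists lam, mu].
(* With lam = 1 the choice mu = nu - omega replaces omega by an arbitrary nu and keeps the
   discriminant - q. *)
have eig nu k : ceigenvalue (lin_comb H K P 1 (nu - omega)) k =
    ((k - 0 +i* nu) ^+ 2 == (- q)%:C) || ((k + 0 +i* nu) ^+ 2 == (- q)%:C).
  by rewrite ceigenvalue_lin_comb !mul1r expr1n mul1r [omega + _]addrC subrK.
have pos : 0 < q -> center_center a g H K P.
  move=> q0; pose t := Num.sqrt q.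
  have t0 : 0 < t by rewrite sqrtr_gt0.
  (* With nu = 2 t the spectrum is 3 t i, - 3 t i, t i, - t i: four distinct non-zero values because
     t > 0. *)
  have spec := center_spectrum (nu := 2 * t) (d := t)
    (A := lin_comb H K P 1 (2 * t - omega)).
  rewrite sqr_sqrtr ?ltW // in spec; have {}spec := spec (eig _).
  have fd : four_distinct_nonzero_eigenvalues (lin_comb H K P 1 (2 * t - omega)).
    apply: (four_distinct_nonzero_eigenvaluesP _ _ _ spec) => //;
      rewrite /= !inE !negb_or !eq_complex /= ?eqxx /=;
      do ![apply/andP; split]; do 1?[apply/eqP => h; lra].
    by [].
  split; [exact: nd fd|exists 1, (2 * t - omega); split=> //].
  by exists (2 * t + t), (2 * t - t).
have neg : q < 0 -> focus_focus a g H K P.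
  move=> q0; pose t := Num.sqrt (- q).
  have t0 : 0 < t by rewrite sqrtr_gt0 oppr_gt0.
  (* Any non-zero nu separates the four values; nu = 1 gives t + i, t - i, - t + i, - t - i. *)
  have spec := focus_spectrum (nu := 1) (d := t)
    (A := lin_comb H K P 1 (1 - omega)).
  rewrite sqr_sqrtr ?oppr_ge0 ?ltW // in spec; have {}spec := spec (eig _).
  have fd : four_distinct_nonzero_eigenvalues (lin_comb H K P 1 (1 - omega)).
    apply: (four_distinct_nonzero_eigenvaluesP _ _ _ spec) => //;
      rewrite /= !inE !negb_or !eq_complex /= ?eqxx ?andbT ?andbF ?negb_and
        /=;
      do ![apply/andP; split]; do ?[apply/orP; left];
      do 1?[apply/eqP => h; lra].
  split; [exact: nd fd|exists 1, (1 - omega); split=> //; exists t, 1].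
  by split; rewrite ?oner_eq0 ?gt_eqF.
split; last by [].
(* If q = 0, the discriminant - lam^2 q vanishes for all lam and mu, so no combination has four
   distinct eigenvalues. *)
split=> [[_ _ [lam [mu fd]]] q0|/eqP].
  apply: (not_four_distinct_nonzero_eigenvalues (nu := lam * omega + mu)) fd => k.
  by rewrite ceigenvalue_lin_comb q0 mulr0 oppr0.
by rewrite neq_lt => /orP[/neg|/pos] [].
Qed.
End Spectrum.

(** * The points on the axis and the value of q *)

Lemma Ppm_coord (R : realType) (a g : R) s : let P := Ppm a g s in
  (S1 P = 0) * (S2 P = 0) * (S3 P = (-1) ^+ s * (g / Num.sqrt a)) *
  (R1 P = 0) * (R2 P = 0) * (R3 P = (-1) ^+ s * Num.sqrt a).
Proof. by rewrite /= !coordE !mxE. Qed.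

Theorem corollary1 (R : realType) (a g beta : R) (g1 g2 g3 V : R * R -> R)
    (a_gt0 : 0 < a) (beta_gt0 : 0 < beta)
    (g1_smooth : smooth_on [set p : R * R | 0 < p.1] g1)
    (g2_smooth : smooth_on [set p : R * R | 0 < p.1] g2)
    (g3_smooth : smooth_on [set p : R * R | 0 < p.1] g3)
    (V_smooth : smooth_on [set p : R * R | 0 < p.1] V)
    (s : bool) :
  let H := hamiltonian beta g1 g2 g3 V in
  let K := @S3 R in
  let P := Ppm a g s in
  let q := qdisc g1 g2 g3 V a g ((-1) ^+ s * Num.sqrt a) in
  [/\ rank0_point a g H K P,
      nondegenerate_rank0 a g H K P <-> q <> 0 &
      nondegenerate_rank0 a g H K P ->
        (0 < q -> center_center a g H K P) /\
        (q < 0 -> focus_focus a g H K P)].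
Proof.
move=> H K P q.
have [[[[[P1 P2] P3] P4] P5] P6] := Ppm_coord a g s.
rewrite -/P in P1 P2 P3 P4 P5 P6.
have sa : Num.sqrt a != 0 by rewrite gt_eqF // sqrtr_gt0.
have P60 : R3 P != 0 by rewrite P6 mulf_neq0 // signr_eq0.
have P6a : R3 P ^+ 2 = a by rewrite P6 exprMn sqrr_sign mul1r sqr_sqrtr // ltW.
have F1P : F1 P = a by rewrite F1E P4 P5 P6a; ring.
have P36 : S3 P * R3 P = g.
  by rewrite P3 P6 mulrACA -expr2 sqrr_sign mul1r divfK.
have F2P : F2 P = g by rewrite F2E P1 P2 P36; ring.
(* Linearizing [sgrad H] requires the formula for dH on a neighbourhood of P, so the domain R^2 > 0
   of the coefficients must contain one. *)
have F1_gt0 : \forall x \near P, 0 < F1 x.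
  have [F1d _] := diff_along_F1 P (fun=> True).
  by apply: cvgr_gt (differentiable_continuous F1d) _ _; rewrite F1P.
have Gd x G : 0 < F1 x -> smooth_on [set p : R * R | 0 < p.1] G ->
    twice_differentiable G (F1 x, R3 x).
  by move=> x0 sm; exact: smooth_twice_differentiable sm _.
have Hd : \forall x \near P, forall e, 'D_e H x = dH beta g1 g2 g3 V x e.
  apply: filterS F1_gt0 => x x0 e.
  by apply: derive_hamiltonian; apply: (Gd _ _ x0 _).1.
have F1P0 : 0 < F1 P by rewrite F1P.
have sgradHd := diff_along_sgrad Hd (fun e => diff_along_dH beta e P1 P2 P4 P5
  (Gd _ _ F1P0 g1_smooth) (Gd _ _ F1P0 g2_smooth) (Gd _ _ F1P0 g3_smooth)
  (Gd _ _ F1P0 V_smooth)).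
pose M := complexH beta g1 g2 g3 V P.
have linH v : tangent v -> v *m jacobian (sgrad H) P = complex_act M v.
  by move=> tv; rewrite (mulmx_jacobian sgradHd) // linear_field.
have rk : rank0_point a g H K P.
  split; first by [].
    rewrite sgrad_field -(ham_field_dH beta g1 g2 g3 V P1 P2 P4 P5).
    by congr ham_field; apply/funext => v; exact: (nbhs_singleton Hd).
  rewrite sgrad_field /ham_field !derive_S3 !basisE P1 P2 P4 P5.
  by apply: coordP; rewrite vec6E coords_zero; ring.
(* i om is half the trace of M and d half the difference of its diagonal entries. *)
pose om := spin beta g2 g3 P - S3 P / 2 - R3 P * g2 (F1 P, R3 P).
pose d := (R3 P * g1 (F1 P, R3 P)) +i* (- (S3 P / 2))%R.
have M00 : M 0 0 = 0 +i* om + d.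
  rewrite mxE /= /d /om; apply/eqP; rewrite eq_complex /=.
  by apply/andP; split; apply/eqP; field.
have M11 : M 1 1 = 0 +i* om - d.
  rewrite mxE /= /d /om; apply/eqP; rewrite eq_complex /=.
  by apply/andP; split; apply/eqP; field.
(* The imaginary parts of the two summands are - R_3 S_3 g_1 and R_3 S_3 g_1. In the real part, g =
   S_3 R_3 turns (S_3 / 2)^2 into g^2 / (4 R_3^2), and R_3 times the derivative of the effective
   potential yields the last three terms of q. *)
have Mq : d ^+ 2 + M 0 1 * M 1 0 = (- q)%:C.
  have -> : q = (S3 P / 2) ^+ 2 - R3 P ^+ 2 * g1 (F1 P, R3 P) ^+ 2
                - R3 P * dVeff g2 g3 V P (0, 1).
    rewrite /q /qdisc /dVeff !partial2E -P6 F2P F1P -P36; field.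
    by [].
  rewrite !mxE /= /d expr2; move: (dVeff _ _ _ _ _) (g1 _) => D c.
  apply/eqP; rewrite eq_complex /=; apply/andP; split; apply/eqP; by field.
have M01 : M 0 1 != 0 by rewrite mxE /= eq_complex /= oppr_eq0 (negPf P60) andbF.
by have [] := nondegenerate_spectrum P1 P2 P4 P5 P60 linH M00 M11 Mq M01 rk.
Qed.
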